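(* Let $\mathbf{k}=(k_1,\dots,k_m)$ be an index (tuple of positive integers), $S=\{i_1<\dots<i_h\}$ a subset of $\{1,\dots,m-1\}$, and $\{j_1<\dots<j_{h'}\}$ the complement of $S$ in $\{1,\dots,m-1\}$. Define $$\mathbf{k}_S=(k_1+\cdots+k_{i_1},\,k_{i_1+1}+\cdots+k_{i_2},\,\dots,\,k_{i_h+1}+\cdots+k_m)$$ and let $m'$ be the depth (length) of $\mathbf{k}_S^{\vee}$. Put $l_1=k_1+\cdots+k_{j_1}-j_1$, $l_2=k_{j_1+1}+\cdots+k_{j_2}-j_2+j_1$, $\dots$, $l_{h'}=k_{j_{h'-1}+1}+\cdots+k_{j_{h'}}-j_{h'}+j_{h'-1}$, and $M_{h'}=k_1+\cdots+k_{j_{h'}}-j_{h'}+h'$. Then the following functional equation holds in $\mathcal{A}_{2,\mathbb{Z}[t_{j_1},\dots,t_{j_{h'}},t_m]}$: $$\Bigl\{\pounds^{\mathrm{sh},\star}_{\mathcal{A}_2,\mathbf{k}}(t_1,\dots,t_m)+\Bigl(\pounds^{\mathrm{sh},\star}_{\mathcal{A}_2,(1,k_1,\dots,k_m)}(1,t_1,\dots,t_m)-\pounds^{\mathrm{sh},\star}_{\mathcal{A}_2,(k_1+1,k_2,\dots,k_m)}(t_1,\dots,t_m)\Bigr)\mathbf{p}\Bigr\}\Big|_{t_{i_1}=\cdots=t_{i_h}=1}$$ $$=\pounds^{\mathrm{sh},\star}_{\mathcal{A}_2,\mathbf{k}_S^{\vee}}(\{1\}^{l_1},1-t_{j_1},\{1\}^{l_2},1-t_{j_2},\dots,\{1\}^{l_{h'}},1-t_{j_{h'}},\{1\}^{m'-M_{h'}-1},1-t_m)$$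 $$-\pounds^{\mathrm{sh},\star}_{\mathcal{A}_2,\mathbf{k}_S^{\vee}}(\{1\}^{l_1},1-t_{j_1},\{1\}^{l_2},1-t_{j_2},\dots,\{1\}^{l_{h'}},1-t_{j_{h'}},\{1\}^{m'-M_{h'}}).$$
   Context: For a commutative ring $R$, $\mathcal{A}_{2,R}=\left(\prod_pR/p^2R\right)/\left(\bigoplus_pR/p^2R\right)$, $p$ running over all primes; elements are written $(a_p)_p$, and two are equal iff their components agree for all but finitely many $p$. $\mathbf{p}=(p\bmod p^2)_p$. $\{1\}^r$ denotes $1$ repeated $r$ times. The finite shuffle star-multiple polylogarithm of an index $\mathbf{k}=(k_1,\dots,k_m)$ is $$\pounds^{\mathrm{sh},\star}_{\mathcal{A}_2,\mathbf{k}}(t_1,\dots,t_m)=\Bigl(\sum_{p-1\ge n_1\ge\cdots\ge n_m\ge1}\frac{t_1^{n_1-n_2}\cdots t_{m-1}^{n_{m-1}-n_m}t_m^{n_m}}{n_1^{k_1}\cdots n_m^{k_m}}\bmod p^2\Bigr)_p\in\mathcal{A}_{2,\mathbb{Z}[t_1,\dots,t_m]};$$ substitution is componentwise. Hoffman dual: for an index $\mathbf{k}=(k_1,\dots,k_m)$ of weight $w=k_1+\cdots+k_m$ put $\psi(\mathbf{k})=\{k_1,k_1+k_2,\dots,k_1+\cdots+k_{m-1}\}$; $\psi$ is a bijection from indices of weight $w$ onto subsets of $\{1,\dots,w-1\}$, and $\mathbf{k}^{\vee}$ is the index of weight $w$ with $\psi(\mathbf{k}^{\vee})=\{1,\dots,w-1\}\setminus\psi(\mathbf{k})$.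 Conventions: if $h=0$ then $\mathbf{k}_S=(k_1+\cdots+k_m)$; if $h'=0$ there are no $l_i$ and no variables $t_{j_i}$, and $M_0=0$. *)

(* Defs.v *)
From HB Require Import structures.
From mathcomp Require Import all_boot all_algebra.
From mathcomp Require Import boolp.
From mathcomp Require Export mpoly.

Set Implicit Arguments.
Unset Strict Implicit.
Unset Printing Implicit Defensive.

Import GRing.Theory.
Local Open Scope ring_scope.
Local Open Scope quotient_scope.

(* The ideals of ring_quotient are proper and live in non-trivial rings. Here
   an ideal may be the whole ring, since R / p^2 R may vanish for a general
   commutative ring R. *)
Record ideal (R : comPzRingType) := Ideal {
  ideal_mem :> R -> bool;
  ideal_zmod_closed : zmod_closed ideal_mem;
  ideal_mull : forall a u, ideal_mem u -> ideal_mem (a * u) }.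

HB.instance Definition _ (R : comPzRingType) (I : ideal R) :=
  GRing.isZmodClosed.Build R (ideal_mem I) (ideal_zmod_closed I).

Definition ring_quot (R : comPzRingType) (I : ideal R) : Type :=
  Quotient.quot (GRing.ZmodClosed.clone R (ideal_mem I) _).

Section RingQuot.
Variables (R : comPzRingType) (I : ideal R).
Local Notation Q := (ring_quot I).

HB.instance Definition _ := GRing.Zmodule.on Q.

Definition quot_proj (a : R) : Q := \pi_Q a.

Lemma quot_proj_eq (a b : R) : quot_proj a = quot_proj b <-> ideal_mem I (a - b).
Proof.
rewrite /quot_proj; split=> [/eqP|h]; last apply/eqP.
  by rewrite -Quotient.idealrBE.
by rewrite -Quotient.idealrBE.
Qed.

Lemma quot_proj_repr (x : Q) : quot_proj (repr x) = x.
Proof. exact: reprK. Qed.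

Lemma quot_proj_is_zmod_morphism : zmod_morphism quot_proj.
Proof.
move=> x y.
exact: (raddfB (\pi_(Quotient.quot (GRing.ZmodClosed.clone R (ideal_mem I) _)))).
Qed.

Definition quot_one : Q := quot_proj 1.
Definition quot_mul (x y : Q) : Q := quot_proj (repr x * repr y).

Lemma quot_proj_mul (a b : R) :
  quot_proj (a * b) = quot_mul (quot_proj a) (quot_proj b).
Proof.
apply/quot_proj_eq.
set a' := repr _; set b' := repr _.
have ha : ideal_mem I (a - a') by apply/quot_proj_eq; rewrite quot_proj_repr.
have hb : ideal_mem I (b - b') by apply/quot_proj_eq; rewrite quot_proj_repr.
have -> : a * b - a' * b' = b * (a - a') - a' * - (b - b').
  by rewrite mulrN opprK !mulrBr addrA [b * a]mulrC [b * a']mulrC subrK.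
have [_ hB] := ideal_zmod_closed I.
apply: (hB _ _); first exact: ideal_mull.
apply: ideal_mull; rewrite -[- _]add0r; apply: (hB _ _) => //.
by have [] := ideal_zmod_closed I.
Qed.

Lemma quot_mulA : associative quot_mul.
Proof.
move=> x y z; rewrite -[x]quot_proj_repr -[y]quot_proj_repr -[z]quot_proj_repr.
by rewrite -!quot_proj_mul mulrA.
Qed.

Lemma quot_mulC : commutative quot_mul.
Proof. by move=> x y; rewrite /quot_mul mulrC. Qed.

Lemma quot_mul1 : left_id quot_one quot_mul.
Proof. by move=> x; rewrite -[x]quot_proj_repr -quot_proj_mul mul1r. Qed.

Lemma quot_projD (a b : R) : quot_proj (a + b) = quot_proj a + quot_proj b.
Proof.
have h := quot_proj_is_zmod_morphism.
have h0 : quot_proj 0 = 0 by rewrite -(subr0 0) h subrr.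
by rewrite -[b in LHS]opprK h -[- b]sub0r h h0 sub0r opprK.
Qed.

Lemma quot_mulDl : left_distributive quot_mul +%R.
Proof.
move=> x y z; rewrite -[x]quot_proj_repr -[y]quot_proj_repr -[z]quot_proj_repr.
by rewrite -quot_projD -!quot_proj_mul mulrDl quot_projD.
Qed.

HB.instance Definition _ := GRing.Zmodule_isComPzRing.Build Q
  quot_mulA quot_mulC quot_mul1 quot_mulDl.
HB.instance Definition _ :=
  GRing.isZmodMorphism.Build R Q quot_proj quot_proj_is_zmod_morphism.
HB.instance Definition _ := GRing.isMonoidMorphism.Build R Q quot_proj
  (erefl, quot_proj_mul).

End RingQuot.

Definition prod_ring (T : Type) (B : T -> comPzRingType) : Type := forall t, B t.

Section ProdRing.
Variables (T : Type) (B : T -> comPzRingType).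
Local Notation P := (prod_ring B).

HB.instance Definition _ := Choice.on P.

Definition prod_zero : P := fun t => 0.
Definition prod_one : P := fun t => 1.
Definition prod_opp (x : P) : P := fun t => - x t.
Definition prod_add (x y : P) : P := fun t => x t + y t.
Definition prod_mul (x y : P) : P := fun t => x t * y t.

Lemma prod_addA : associative prod_add.
Proof. by move=> x y z; apply: functional_extensionality_dep => t; apply: addrA. Qed.
Lemma prod_addC : commutative prod_add.
Proof. by move=> x y; apply: functional_extensionality_dep => t; apply: addrC. Qed.
Lemma prod_add0 : left_id prod_zero prod_add.
Proof. by move=> x; apply: functional_extensionality_dep => t; apply: add0r. Qed.
Lemma prod_addN : left_inverse prod_zero prod_opp prod_add.
Proof. by move=> x; apply: functional_extensionality_dep => t; apply: addNr. Qed.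

HB.instance Definition _ :=
  GRing.isZmodule.Build P prod_addA prod_addC prod_add0 prod_addN.

Lemma prod_mulA : associative prod_mul.
Proof. by move=> x y z; apply: functional_extensionality_dep => t; apply: mulrA. Qed.
Lemma prod_mulC : commutative prod_mul.
Proof. by move=> x y; apply: functional_extensionality_dep => t; apply: mulrC. Qed.
Lemma prod_mul1 : left_id prod_one prod_mul.
Proof. by move=> x; apply: functional_extensionality_dep => t; apply: mul1r. Qed.
Lemma prod_mulDl : left_distributive prod_mul prod_add.
Proof. by move=> x y z; apply: functional_extensionality_dep => t; apply: mulrDl. Qed.

HB.instance Definition _ := GRing.Zmodule_isComPzRing.Build P
  prod_mulA prod_mulC prod_mul1 prod_mulDl.

End ProdRing.

Definition prime_nat : Type := {p : nat | prime p}.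
HB.instance Definition _ := Equality.on prime_nat.
Definition prime_val (p : prime_nat) : nat := val p.
Coercion prime_val : prime_nat >-> nat.

Section A2.
Variable R : comPzRingType.

Definition p2_mem (p : nat) (x : R) : bool := `[< exists y, x = (p ^ 2)%:R * y >].

Lemma p2_zmod_closed p : zmod_closed (p2_mem p).
Proof.
split; first by apply/asboolP; exists 0; rewrite mulr0.
move=> x y /asboolP[u ->] /asboolP[v ->].
by apply/asboolP; exists (u - v); rewrite mulrBr.
Qed.

Lemma p2_mull p a u : p2_mem p u -> p2_mem p (a * u).
Proof. by move=> /asboolP[v ->]; apply/asboolP; exists (a * v); rewrite mulrCA. Qed.

Definition p2_ideal (p : nat) : ideal R := Ideal (p2_zmod_closed p) (@p2_mull p).

Definition mod_p2 (p : nat) : comPzRingType := ring_quot (p2_ideal p).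

Definition prod_mod_p2 : comPzRingType := prod_ring (fun p : prime_nat => mod_p2 p).

Definition fin_supp (x : prod_mod_p2) : bool :=
  `[< exists s : seq prime_nat, forall p, p \notin s -> x p = 0 >].

Lemma fin_supp_zmod_closed : zmod_closed fin_supp.
Proof.
split; first by apply/asboolP; exists [::].
move=> x y /asboolP[s hs] /asboolP[s' hs']; apply/asboolP; exists (s ++ s') => p.
rewrite mem_cat negb_or => /andP[ps ps'].
by rewrite [LHS](_ : _ = x p - y p) // hs // hs' // subr0.
Qed.

Lemma fin_supp_mull a u : fin_supp u -> fin_supp (a * u).
Proof.
move=> /asboolP[s hs]; apply/asboolP; exists s => p ps.
by rewrite [LHS](_ : _ = a p * u p) // hs // mulr0.
Qed.

Definition fin_supp_ideal : ideal prod_mod_p2 :=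
  Ideal fin_supp_zmod_closed fin_supp_mull.

Definition A2 : comPzRingType := ring_quot fin_supp_ideal.

Definition A2_class (x : prod_mod_p2) : A2 := quot_proj fin_supp_ideal x.

Lemma A2_class_eq (x y : prod_mod_p2) : A2_class x = A2_class y <->
  exists s : seq prime_nat, forall p, p \notin s -> x p = y p.
Proof.
apply: iff_trans (quot_proj_eq _ _ _) _.
split=> [/asboolP[s hs]|[s hs]]; last apply/asboolP.
  by exists s => p /hs /(congr1 (+%R^~ (y p))); rewrite add0r => <-; rewrite subrK.
by exists s => p /hs h; rewrite [LHS](_ : _ = x p - y p) // h subrr.
Qed.

Definition A2_p : A2 := A2_class (fun p => (p : nat)%:R).

End A2.

Arguments A2_p R : clear implicits.

Section QuotMap.
Variables (R S : comPzRingType) (I : ideal R) (J : ideal S) (f : {rmorphism R -> S}).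

Definition quot_map (x : ring_quot I) : ring_quot J := quot_proj J (f (repr x)).

Hypothesis fIJ : forall a, ideal_mem I a -> ideal_mem J (f a).

Lemma quot_mapE a : quot_map (quot_proj I a) = quot_proj J (f a).
Proof.
apply/quot_proj_eq; rewrite -rmorphB; apply: fIJ.
by apply/quot_proj_eq; rewrite quot_proj_repr.
Qed.

Lemma quot_map_is_zmod_morphism : zmod_morphism quot_map.
Proof.
move=> x y; rewrite -[x]quot_proj_repr -[y]quot_proj_repr -rmorphB !quot_mapE.
by rewrite !rmorphB.
Qed.

Lemma quot_map_is_monoid_morphism : monoid_morphism quot_map.
Proof.
split=> [|x y]; first by rewrite -(rmorph1 (quot_proj I)) quot_mapE !rmorph1.
rewrite -[x]quot_proj_repr -[y]quot_proj_repr -rmorphM !quot_mapE.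
by rewrite !rmorphM.
Qed.

End QuotMap.

Section A2Map.
Variables (R S : comPzRingType) (f : {rmorphism R -> S}).

Definition mod_p2_map (p : nat) : mod_p2 R p -> mod_p2 S p :=
  quot_map (p2_ideal S p) f.

Lemma mod_p2_map_ideal p a :
  ideal_mem (p2_ideal R p) a -> ideal_mem (p2_ideal S p) (f a).
Proof.
by move=> /asboolP[b ->]; apply/asboolP; exists (f b); rewrite rmorphM rmorph_nat.
Qed.

HB.instance Definition _ p := GRing.isZmodMorphism.Build _ _ (@mod_p2_map p)
  (quot_map_is_zmod_morphism (@mod_p2_map_ideal p)).
HB.instance Definition _ p := GRing.isMonoidMorphism.Build _ _ (@mod_p2_map p)
  (quot_map_is_monoid_morphism (@mod_p2_map_ideal p)).

Lemma mod_p2_mapE p a :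
  mod_p2_map (quot_proj (p2_ideal R p) a) = quot_proj (p2_ideal S p) (f a).
Proof. exact: (quot_mapE (@mod_p2_map_ideal p)). Qed.

Definition prod_mod_p2_map (x : prod_mod_p2 R) : prod_mod_p2 S :=
  fun p => mod_p2_map (x p).

Lemma prod_mod_p2_map_is_zmod_morphism : zmod_morphism prod_mod_p2_map.
Proof.
by move=> x y; apply: functional_extensionality_dep => p; apply: rmorphB.
Qed.
Lemma prod_mod_p2_map_is_monoid_morphism : monoid_morphism prod_mod_p2_map.
Proof.
split=> [|x y]; apply: functional_extensionality_dep => p.
  exact: (rmorph1 (@mod_p2_map p)).
exact: rmorphM.
Qed.
HB.instance Definition _ := GRing.isZmodMorphism.Build _ _ prod_mod_p2_map
  prod_mod_p2_map_is_zmod_morphism.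
HB.instance Definition _ := GRing.isMonoidMorphism.Build _ _ prod_mod_p2_map
  prod_mod_p2_map_is_monoid_morphism.

Definition A2_map : A2 R -> A2 S := quot_map (fin_supp_ideal S) prod_mod_p2_map.

Lemma A2_map_ideal x :
  ideal_mem (fin_supp_ideal R) x -> ideal_mem (fin_supp_ideal S) (prod_mod_p2_map x).
Proof.
move=> /asboolP[s hs]; apply/asboolP; exists s => p /hs h.
by rewrite /prod_mod_p2_map h rmorph0.
Qed.

HB.instance Definition _ := GRing.isZmodMorphism.Build _ _ A2_map
  (quot_map_is_zmod_morphism A2_map_ideal).
HB.instance Definition _ := GRing.isMonoidMorphism.Build _ _ A2_map
  (quot_map_is_monoid_morphism A2_map_ideal).

Lemma A2_mapE x : A2_map (A2_class x) = A2_class (prod_mod_p2_map x).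
Proof. exact: (quot_mapE A2_map_ideal). Qed.

Lemma A2_map_p : A2_map (A2_p R) = A2_p S.
Proof.
rewrite /A2_p A2_mapE; congr A2_class; apply: functional_extensionality_dep => p.
exact: (rmorph_nat (@mod_p2_map p)).
Qed.

End A2Map.

(* The inverse of a unit; the value at a non-unit is irrelevant. *)
Definition pz_inv (Q : comPzRingType) (a : Q) : Q :=
  if pselect (exists b, a * b = 1) is left ab then projT1 (cid ab) else 0.

Lemma pz_invP (Q : comPzRingType) (a b : Q) : a * b = 1 -> pz_inv a = b.
Proof.
move=> ab; rewrite /pz_inv; case: pselect => [h|[]]; last by exists b.
case: (cid h) => c /= ac; by rewrite -[c]mul1r -ab mulrAC ac mul1r.
Qed.

Lemma natr_mod_p2_unit (R : comPzRingType) (p n : nat) :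
  prime p -> (0 < n < p)%N -> exists b : mod_p2 R p, n%:R * b = 1.
Proof.
move=> pp /andP[n0 np].
have cop : coprime n (p ^ 2).
  by rewrite coprimeXr // coprime_sym prime_coprime // gtnNdvd.
have p2 : (p ^ 2)%:R = 0 :> mod_p2 R p.
  rewrite -(rmorph_nat (quot_proj (p2_ideal R p))) -(rmorph0 (quot_proj (p2_ideal R p))).
  by apply/quot_proj_eq; rewrite subr0; apply/asboolP; exists 1; rewrite mulr1.
case: (egcdnP (p ^ 2) n0) => km kn e _; exists km%:R.
by rewrite -natrM mulnC e (eqP cop) natrD natrM p2 mulr0 add0r.
Qed.

(* Sum over p > n_1 >= ... >= n_m >= 1 for the sequence n = (n_1, ..., n_m);
   n_(m+1) reads as 0, so that the last variable gets the exponent n_m. *)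
Definition polylog_sum (Q : comPzRingType) (p : nat) (k : seq nat) (x : seq Q) : Q :=
  \sum_(n : (size k).-tuple 'I_p
        | sorted geq (map val n) && all (leq 1) (map val n))
    \prod_(i < size k)
      (nth 0 x i ^+ (nth 0 (map val n) i - nth 0 (map val n) i.+1)%N
       * pz_inv ((nth 0%N (map val n) i)%:R ^+ nth 0%N k i)).

(* The finite shuffle star-multiple polylogarithm of index k with the elements
   x_1, ..., x_m of R substituted for t_1, ..., t_m; cf. A2_map_polylog. *)
Definition polylog (R : comPzRingType) (k : seq nat) (x : seq R) : A2 R :=
  A2_class (fun p : prime_nat =>
    polylog_sum p k [seq quot_proj (p2_ideal R p) a | a <- x]).

Lemma A2_map_polylog (R S : comPzRingType) (f : {rmorphism R -> S}) k (x : seq R) :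
  A2_map f (polylog k x) = polylog k (map f x).
Proof.
rewrite A2_mapE; congr A2_class; apply: functional_extensionality_dep => p.
rewrite /prod_mod_p2_map /polylog_sum rmorph_sum; apply: eq_bigr => n /andP[_ n1].
rewrite rmorph_prod; apply: eq_bigr => i _; rewrite rmorphM rmorphXn.
congr (_ ^+ _ * _).
  have [ix|xi] := ltnP i (size x).
    by rewrite !(nth_map 0) ?size_map //; apply: mod_p2_mapE.
  by rewrite !nth_default ?size_map // rmorph0.
set v := nth _ _ _; set e := nth _ _ _.
have iv : (i < size (map val n))%N by rewrite size_map size_tuple.
have vp : (0 < v < p)%N.
  rewrite (allP n1 _ (mem_nth 0 iv)) /v (nth_map (tnth n i)) ?size_tuple //.
  exact: ltn_ord.
have [b hb] := natr_mod_p2_unit R (valP p) vp.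
have he : v%:R ^+ e * b ^+ e = 1 by rewrite -exprMn hb expr1n.
rewrite (pz_invP he); apply/esym/pz_invP.
by have := congr1 (mod_p2_map f (p := p)) he; rewrite rmorphM rmorphXn rmorph_nat rmorph1.
Qed.

Definition is_index (k : seq nat) : bool := (0 < size k)%N && all (leq 1) k.

Definition psi (k : seq nat) : seq nat :=
  [seq sumn (take i k) | i <- iota 1 (size k).-1].

(* The inverse of psi on the subsets s of {1, ..., w - 1}, listed in increasing
   order; see psiK and index_ofK. *)
Definition index_of (w : nat) (s : seq nat) : seq nat :=
  pairmap (fun a b => (b - a)%N) 0%N (rcons s w).

Definition hoffman_dual (k : seq nat) : seq nat :=
  index_of (sumn k) [seq i <- iota 1 (sumn k).-1 | i \notin psi k].

Lemma psiK k : is_index k -> index_of (sumn k) (psi k) = k.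
Proof.
case/andP=> k0 _; rewrite /index_of /psi.
have -> : rcons [seq sumn (take i k) | i <- iota 1 (size k).-1] (sumn k)
        = [seq (0 + sumn (take i k))%N | i <- iota 1 (size k)].
  have e : size k = ((size k).-1 + 1)%N by rewrite addn1 prednK.
  by rewrite [in RHS]e iotaD map_cat cats1 /= add1n prednK // take_size.
suff gen a : pairmap (fun a b => (b - a)%N) a
    [seq (a + sumn (take i k))%N | i <- iota 1 (size k)] = k by exact: gen.
elim: k {k0} a => [|x k IH] a //=.
rewrite take0 /= addn0 addKn; congr cons.
rewrite -[in RHS](IH (a + x)%N) (iotaDl 1 1) -map_comp; congr pairmap.
by apply: eq_map => i /=; rewrite addnA.
Qed.

Lemma sumn_take_diff a t i : path ltn a t -> (i <= size t)%N ->
  (a + sumn (take i (pairmap (fun a b => (b - a)%N) a t)))%N = nth a (a :: t) i.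
Proof.
elim: t a i => [|b t IH] a [|i] //=; rewrite ?addn0 //.
move=> /andP[ab pt] it; rewrite addnA subnKC; last exact: ltnW.
rewrite IH //; case: i it => [|i] //= it; exact: set_nth_default.
Qed.

Lemma index_ofK w s : (0 < w)%N -> sorted ltn s -> all (fun i => 0 < i < w)%N s ->
  [/\ is_index (index_of w s), sumn (index_of w s) = w & psi (index_of w s) = s].
Proof.
move=> w0 ss sw; have pt : path ltn 0 (rcons s w).
  rewrite rcons_path; apply/andP; split.
    case: s ss sw => //= x s -> /andP[/andP[-> _] _] //.
  case/lastP: s ss sw => //= s x _; rewrite all_rcons last_rcons.
  by case/andP=> /andP[].
have sz : size (index_of w s) = (size s).+1 by rewrite size_pairmap size_rcons.
split.
- rewrite /is_index sz /= /index_of.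
  have gen a t : path ltn a t -> all (leq 1) (pairmap (fun a b => (b - a)%N) a t).
    by elim: t a => //= b t IH a /andP[ab /IH ->]; rewrite subn_gt0 ab.
  exact: gen.
- have := @sumn_take_diff 0 (rcons s w) (size s).+1 pt.
  by rewrite -/(index_of w s) -sz take_size sz size_rcons leqnn /= nth_rcons
             ltnn eqxx; apply.
- rewrite /psi sz /=; apply: (@eq_from_nth _ 0%N); first by rewrite size_map size_iota.
  move=> i; rewrite size_map size_iota => si.
  rewrite (nth_map 0%N) ?size_iota // nth_iota // add1n.
  have := @sumn_take_diff 0 (rcons s w) i.+1 pt.
  rewrite add0n size_rcons => -> /=; last exact: leqW.
  by rewrite nth_rcons si.
Qed.

Lemma hoffman_dualP k : is_index k ->
  [/\ is_index (hoffman_dual k), sumn (hoffman_dual k) = sumn k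
    & psi (hoffman_dual k) = [seq i <- iota 1 (sumn k).-1 | i \notin psi k]].
Proof.
case/andP=> k0 k1; have w0 : (0 < sumn k)%N.
  by case: k k0 k1 => //= x k _ /andP[x1 _]; rewrite ltn_addr.
apply: index_ofK => //; first exact: (sorted_filter ltn_trans _ (iota_ltn_sorted 1 _)).
apply/allP=> i; rewrite mem_filter mem_iota add1n prednK //.
by case/andP.
Qed.

(* k_(a+1) + ... + k_b, with the 1-based numbering of the index k. *)
Definition block_sum (k : seq nat) (a b : nat) : nat := (\sum_(a <= i < b) nth 0 k i)%N.

(* k_S, for S listed in increasing order. *)
Definition merge_index (k S : seq nat) : seq nat :=
  pairmap (block_sum k) 0%N (rcons S (size k)).

(* j_1 < ... < j_h', the complement of S in {1, ..., m - 1}. *)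
Definition compl (k S : seq nat) : seq nat :=
  [seq j <- iota 1 (size k).-1 | j \notin S].

(* l_1, ..., l_h', where j_0 = 0. *)
Definition ones_lengths (k j : seq nat) : seq nat :=
  pairmap (fun a b => (block_sum k a b + a - b)%N) 0%N j.

(* M_h'; last 0 j is j_h' if h' > 0 and 0 otherwise. *)
Definition M_last (k j : seq nat) : nat :=
  (block_sum k 0 (last 0 j) - last 0 j + size j)%N.

(* {1}^(l_1), 1 - t_(j_1), ..., {1}^(l_h'), 1 - t_(j_h'). *)
Definition dual_args (R : comPzRingType) (k j : seq nat) (t : nat -> R) : seq R :=
  flatten [seq rcons (nseq lj.1 1) (1 - t lj.2) | lj <- zip (ones_lengths k j) j].

(* The variable t_i of Z[t_(j_1), ..., t_(j_h'), t_m], for i among j_1, ..., j_h'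
   or i = m: the polynomial ring has the variables 'X_0, ..., 'X_h', of which
   'X_(a-1) is t_(j_a) and 'X_h' is t_m. *)
Definition tvar (j : seq nat) (i : nat) : {mpoly int[(size j).+1]} :=
  'X_(inord (index i j)).

(* The images of t_1, ..., t_m under t_(i_1) = ... = t_(i_h) = 1. *)
Definition subst1 (k S : seq nat) :
    (size k).-tuple {mpoly int[(size (compl k S)).+1]} :=
  [tuple if i.+1 \in S then 1 else tvar (compl k S) i.+1 | i < size k].

Definition vars (n : nat) : seq {mpoly int[n]} := [seq 'X_i | i : 'I_n].

(* Main.v *)
Require Import Defs.
From mathcomp Require Import all_boot all_algebra.
From mathcomp Require Import boolp ring zify.

Set Implicit Arguments.
Unset Strict Implicit.
Unset Printing Implicit Defensive.

Import GRing.Theory.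
Local Open Scope ring_scope.

(** The identity is the binomial transform a |-> sum_i (-1)^i C(n, i) a_i
    applied to a nested sum.

    Every star sum is an iterate of one operator, twisted by a letter t:
    (T_t a)_n = sum_(1 <= i <= n) t^(n - i) a_i / i.  Extreme letters have
    simple meanings: T_1 is a plain summation of a_i / i, and T_0 is the
    division a_n / n.  Hence the sum with index k and arguments x is obtained by
    applying to the powers z^n of the last argument the operators T of the
    letters 1, 0^(k_1 - 1), x_1, 0^(k_2 - 1), x_2, ... ([polylog_sum_chain]);
    a letter 0 glues two neighbouring summation variables together, and so
    encodes an exponent larger than 1.

    The binomial transform turns the shift into 1 minus the shift, and T_t is
    the solution operator of a first-order recurrence in the shift, so it turns
    T_t into T_(1 - t); the initial value a_0 is subtracted on the way
    ([binomial_transform_star_step], [binomial_transform_chain]).  It turns z^n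
    into (1 - z)^n, and the subtracted initial value 1 yields the second sum on
    the right-hand side of the theorem.  This duality is exact as soon as the
    integers below p are invertible.

    Modulo p^2, (-1)^n C(p - 1, n) = 1 + p sum_(n < i < p) 1 / i for odd p
    ([signed_bin_mod_sqr]), so the left-hand side of the theorem, whose
    correction terms multiplied by p supply exactly these harmonic sums, is the
    binomial transform of the nested sum at p - 1
    ([polylog_sum_correction]).

    There remains a statement about words.  With t_i = 1 for i in S, the letters
    1 - t of the transformed word vanish exactly at the positions
    k_1 + ... + k_i with i in S, which is the complement of psi of the Hoffman
    dual of k_S.  Reading the zero letters as glue, the transformed word is the
    word of that dual index, with the remaining letters as arguments
    ([word_dual_args]).  The prime 2 is discarded. *)

(** * Twisted harmonic summation and the binomial transform *)

Definition units_below (Q : comPzRingType) (p : nat) : Prop :=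
  forall n, (0 < n < p)%N -> exists b : Q, n%:R * b = 1.

Lemma mulr_pz_inv (Q : comPzRingType) (p n : nat) :
  units_below Q p -> (0 < n < p)%N -> n%:R * pz_inv (n%:R : Q) = 1.
Proof. by move=> up /up[b nb]; rewrite (pz_invP nb). Qed.

(** The sum over 1 <= i <= n, shifted by one: the value of a at 0 is never read,
    so that no inverse of 0 enters. *)
Definition star_step (Q : comPzRingType) (t : Q) (a : nat -> Q) (n : nat) : Q :=
  \sum_(i < n) t ^+ (n - i.+1) * (pz_inv (i.+1)%:R * a i.+1).

Lemma star_step0 (Q : comPzRingType) (t : Q) a : star_step t a 0 = 0.
Proof. by rewrite /star_step big_ord0. Qed.

Lemma star_stepS (Q : comPzRingType) (t : Q) a n :
  star_step t a n.+1 = t * star_step t a n + pz_inv (n.+1)%:R * a n.+1.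
Proof.
rewrite /star_step big_ord_recr /= subnn expr0 mul1r mulr_sumr; congr (_ + _).
by apply: eq_bigr => i _; rewrite (subSn (ltn_ord i)) exprS -mulrA.
Qed.

Lemma eq_star_step (Q : comPzRingType) (t : Q) a b n :
  (forall i, (i <= n)%N -> a i = b i) -> star_step t a n = star_step t b n.
Proof. by move=> ab; apply: eq_bigr => i _; rewrite ab. Qed.

Lemma star_stepB (Q : comPzRingType) (t : Q) a b n :
  star_step t (fun i => a i - b i) n = star_step t a n - star_step t b n.
Proof. by rewrite /star_step -sumrB; apply: eq_bigr => i _; rewrite !mulrBr. Qed.

Lemma star_step_zero (Q : comPzRingType) (a : nat -> Q) n :
  star_step 0 a n.+1 = pz_inv (n.+1)%:R * a n.+1.
Proof. by rewrite star_stepS mul0r add0r. Qed.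

Definition binomial_transform (Q : comPzRingType) (a : nat -> Q) (n : nat) : Q :=
  \sum_(i < n.+1) (-1) ^+ i * 'C(n, i)%:R * a i.

(** Pascal's rule: the transform conjugates the shift E into 1 - E. *)
Lemma binomial_transformS (Q : comPzRingType) (a : nat -> Q) n :
  binomial_transform a n.+1
  = binomial_transform a n - binomial_transform (fun i => a i.+1) n.
Proof.
have -> : binomial_transform a n
        = \sum_(i < n.+2) (-1) ^+ i * 'C(n, i)%:R * a i.
  by rewrite big_ord_recr /= bin_small // mulr0 mul0r addr0.
rewrite /binomial_transform big_ord_recl [in RHS]big_ord_recl !bin0 -addrA.
congr (_ + _); rewrite -sumrB; apply: eq_bigr => i _.
rewrite /= /bump leq0n add1n binS natrD exprS; ring.
Qed.

Lemma eq_binomial_transform (Q : comPzRingType) (a b : nat -> Q) n :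
  (forall i, a i = b i) -> binomial_transform a n = binomial_transform b n.
Proof. by move=> ab; apply: eq_bigr => i _; rewrite ab. Qed.

Lemma binomial_transformD (Q : comPzRingType) (a b : nat -> Q) (t : Q) n :
  binomial_transform (fun i => t * a i + b i) n
  = t * binomial_transform a n + binomial_transform b n.
Proof.
by rewrite /binomial_transform mulr_sumr -big_split; apply: eq_bigr => i _ /=; ring.
Qed.

(** From (n + 1) C(n, i) = (i + 1) C(n + 1, i + 1): the sequence a_i / i keeps its
    shape under the transform, except that a_0 is subtracted. *)
Lemma binomial_transform_div (Q : comPzRingType) (p : nat) (a : nat -> Q) n :
  units_below Q p -> (n.+1 < p)%N ->
  binomial_transform (fun i => pz_inv (i.+1)%:R * a i.+1) n
  = pz_inv (n.+1)%:R * (a 0%N - binomial_transform a n.+1).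
Proof.
move=> up np; have un := mulr_pz_inv up (np : (0 < n.+1 < p)%N).
suff <- : (n.+1)%:R * binomial_transform (fun i => pz_inv (i.+1)%:R * a i.+1) n
        = a 0%N - binomial_transform a n.+1 by rewrite mulrA [_ * _%:R]mulrC un mul1r.
rewrite {2}/binomial_transform big_ord_recl bin0 !mul1r opprD addrA subrr add0r.
rewrite /binomial_transform mulr_sumr -sumrN; apply: eq_bigr => i _.
have ui : (i.+1)%:R * pz_inv (i.+1)%:R = 1 :> Q.
  by apply: (mulr_pz_inv up); have := ltn_ord i; lia.
have bi : (n.+1)%:R * 'C(n, i)%:R = (i.+1)%:R * 'C(n.+1, i.+1)%:R :> Q.
  by rewrite -!natrM (mul_bin_diag n.+1 i).
rewrite /= /bump leq0n add1n exprS.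
transitivity ((-1) ^+ i * ((n.+1)%:R * 'C(n, i)%:R) * (pz_inv (i.+1)%:R * a i.+1)).
  ring.
rewrite bi; transitivity
  ((-1) ^+ i * 'C(n.+1, i.+1)%:R * ((i.+1)%:R * pz_inv (i.+1)%:R) * a i.+1).
  ring.
by rewrite ui; ring.
Qed.

(** The sequence c = T_t a is characterized by (E - t) c_n = a_(n+1) / (n + 1) for
    the shift E.  The transform replaces E - t by (1 - t) - E, hence t by 1 - t. *)
Lemma binomial_transform_star_step (Q : comPzRingType) (p : nat) (t : Q) a n :
  units_below Q p -> (n < p)%N ->
  binomial_transform (star_step t a) n
  = star_step (1 - t) (fun i => binomial_transform a i - a 0%N) n.
Proof.
move=> up; elim: n => [|n IH] np.
  by rewrite /binomial_transform big_ord1 !star_step0 mulr0.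
rewrite binomial_transformS (eq_binomial_transform n (star_stepS t a)).
rewrite binomial_transformD (binomial_transform_div _ up np) IH ?(ltnW np) //.
by rewrite star_stepS; ring.
Qed.

Lemma binomial_transform_exp (Q : comPzRingType) (x : Q) n :
  binomial_transform (fun i => x ^+ i) n = (1 - x) ^+ n.
Proof.
elim: n => [|n IH]; first by rewrite /binomial_transform big_ord1 !expr0 !mul1r.
rewrite binomial_transformS IH.
have -> : binomial_transform (fun i => x ^+ i.+1) n = x * (1 - x) ^+ n.
  rewrite -IH /binomial_transform mulr_sumr; apply: eq_bigr => i _.
  by rewrite exprS; ring.
by rewrite exprS; ring.
Qed.

(** Operators are applied from the right: the last letter of the word gives the
    powers z^n on which the operators of the other letters act. *)
Fixpoint chain (Q : comPzRingType) (w : seq Q) : nat -> Q :=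
  match w with
  | [::] => fun n => 0 ^+ n
  | [:: z] => fun n => z ^+ n
  | t :: w' => star_step t (chain w')
  end.

Lemma chain_cons (Q : comPzRingType) (t : Q) w :
  (0 < size w)%N -> chain (t :: w) = star_step t (chain w).
Proof. by case: w. Qed.

(** All letters t become 1 - t.  The initial value is nonzero only for the
    innermost sequence z^n, where subtracting it amounts to subtracting 1^n;
    keeping [chain _ 0] on the left makes this base case uniform with the
    inductive step. *)
Lemma binomial_transform_chain (Q : comPzRingType) (p : nat) (w : seq Q) (z : Q) n :
  units_below Q p -> (n < p)%N ->
  let w' := [seq 1 - t | t <- w] in
  binomial_transform (chain (rcons w z)) n - chain (rcons w z) 0
  = chain (rcons w' (1 - z)) n - chain (rcons w' 1) n.
Proof.
move=> up /=; elim: w n => [|t w IH] n np.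
  by rewrite /= binomial_transform_exp expr1n.
rewrite map_cons !rcons_cons !chain_cons ?size_rcons // star_step0 subr0.
rewrite (binomial_transform_star_step _ _ up np) -star_stepB.
by apply: eq_star_step => i ni; apply: IH; apply: leq_ltn_trans np.
Qed.

(** Descending induction from n = p - 1, where the sign is + because p is odd.
    The ratio of two consecutive terms is 1 - p / (n + 1), whose inverse modulo
    p^2 is 1 + p / (n + 1).  Starting from the top end avoids any evaluation of
    harmonic sums modulo p. *)
Lemma signed_bin_mod_sqr (Q : comPzRingType) (p n : nat) :
  units_below Q p -> p%:R * p%:R = 0 :> Q -> odd p -> (n < p)%N ->
  (-1) ^+ n * 'C(p.-1, n)%:R
  = 1 + p%:R * \sum_(n <= i < p.-1) pz_inv (i.+1)%:R :> Q.
Proof.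
move=> up pp odp np.
have -> : n = (p.-1 - (p.-1 - n))%N by lia.
have : (p.-1 - n <= p.-1)%N by lia.
elim: (p.-1 - n)%N => [|d IH] dp.
  rewrite subn0 binn mulr1 big_geq // mulr0 addr0 -signr_odd.
  by have -> : odd p.-1 = false by lia.
move/(_ (ltnW dp)): IH; set m := (p.-1 - d.+1)%N.
have -> : (p.-1 - d = m.+1)%N by rewrite /m; lia.
have mp : (0 < m.+1 < p)%N by rewrite /m; lia.
have um := mulr_pz_inv up mp.
move=> IH; rewrite big_ltn; last by rewrite /m; lia.
move: IH; set c := 'C(_, _)%:R; set e := 'C(_, _)%:R; set s := \sum_(_ <= _ < _) _.
move=> IH.
have ce : (m.+1)%:R * c = (p%:R - (m.+1)%:R) * e.
  rewrite -natrB; last by lia.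
  rewrite -!natrM; congr _%:R.
  by rewrite -[in LHS](prednK (_ : 0 < m.+1)%N) // mul_bin_left; congr muln; lia.
have {}ce : c = (p%:R * pz_inv (m.+1)%:R - 1) * e.
  rewrite -[c]mul1r -um mulrAC ce mulrAC mulrBl um; ring.
(* Up to the square of p, 1 + p / (m + 1) is the inverse of 1 - p / (m + 1). *)
transitivity (((-1) ^+ m.+1 * c) * (1 + p%:R * pz_inv (m.+1)%:R)).
  rewrite ce exprS; set v := pz_inv _.
  transitivity ((-1) ^+ m * e * (1 - (p%:R * p%:R) * (v * v))); last ring.
  by rewrite pp mul0r subr0 mulr1.
rewrite IH; set v := pz_inv _.
transitivity (1 + p%:R * (v + s) + (p%:R * p%:R) * (s * v)); first ring.
by rewrite pp mul0r addr0.
Qed.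

(** Exchanging the two summations gives each term the weight
    sum_(i >= n) 1 / i; the subtracted sum removes the diagonal i = n. *)
Lemma star_step_one_correction (Q : comPzRingType) (h : nat -> Q) N :
  star_step 1 (star_step 1 h) N - star_step 1 (star_step 0 h) N
  = \sum_(n < N) (\sum_(n.+1 <= i < N) pz_inv (i.+1)%:R) * star_step 0 h n.+1.
Proof.
elim: N => [|N IH]; first by rewrite !star_step0 big_ord0 subrr.
rewrite big_ord_recr /= big_geq // mul0r addr0.
transitivity (star_step 1 (star_step 1 h) N - star_step 1 (star_step 0 h) N
  + pz_inv (N.+1)%:R * star_step 1 h N).
  by rewrite !(star_stepS 1) star_step_zero; ring.
rewrite IH /star_step mulr_sumr -big_split; apply: eq_bigr => n _ /=.
rewrite -/(star_step 0 h n.+1) star_step_zero expr1n mul1r.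
rewrite [in RHS]big_nat_recr //=; ring.
Qed.

Lemma binomial_transform_mod_sqr (Q : comPzRingType) (p : nat) (h : nat -> Q) :
  units_below Q p -> p%:R * p%:R = 0 :> Q -> odd p ->
  star_step 1 h p.-1
  + (star_step 1 (star_step 1 h) p.-1 - star_step 1 (star_step 0 h) p.-1) * p%:R
  = binomial_transform (star_step 0 h) p.-1.
Proof.
move=> up pp odp.
rewrite star_step_one_correction /binomial_transform big_ord_recl star_step0 mulr0 add0r.
rewrite mulr_suml {1}/star_step -big_split; apply: eq_bigr => n _.
rewrite /= /bump leq0n add1n (signed_bin_mod_sqr up pp odp); last first.
  by have := ltn_ord n; lia.
by rewrite expr1n mul1r star_step_zero; ring.
Qed.

(** * Polylogarithm sums as iterated operators *)

(** Each entry k_i contributes k_i letters: one for the incoming variable, then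
    k_i - 1 zeros, each of which divides once more by the same summation
    variable. *)
Fixpoint word (R : comPzRingType) (y : R) (k : seq nat) (x : seq R) : seq R :=
  if k is k0 :: k' then y :: nseq k0.-1 0 ++ word (head 0 x) k' (behead x)
  else [:: y].

Lemma word_neq0 (R : comPzRingType) (y : R) k x : (0 < size (word y k x))%N.
Proof. by case: k. Qed.

Lemma map_word (R S : comPzRingType) (f : {rmorphism R -> S}) y k x :
  map f (word y k x) = word (f y) k (map f x).
Proof.
elim: k y x => [|k0 k IH] y x //=.
rewrite map_cat map_nseq rmorph0 IH.
by case: x => //=; rewrite rmorph0.
Qed.

Lemma chain_zeros (Q : comPzRingType) e (w : seq Q) n : (0 < size w)%N ->
  chain (nseq e 0 ++ w) n.+1 = pz_inv (n.+1)%:R ^+ e * chain w n.+1.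
Proof.
move=> w0; elim: e => [|e IH]; first by rewrite expr0 mul1r.
rewrite [nseq _ _ ++ _]/= chain_cons; last by rewrite size_cat addn_gt0 w0 orbT.
by rewrite star_step_zero IH exprS mulrA.
Qed.

(** Stated for functions of the list of values, so that the nested sums can be
    peeled from the outside without handling tuple casts. *)
Lemma sum_tuple_cons (Q : comPzRingType) (p m : nat) (P : pred (seq nat))
    (F : seq nat -> Q) :
  \sum_(s : m.+1.-tuple 'I_p | P (map val s)) F (map val s)
  = \sum_(a < p) \sum_(s : m.-tuple 'I_p | P (val a :: map val s))
      F (val a :: map val s).
Proof.
rewrite pair_big_dep /=.
rewrite (reindex (fun q : 'I_p * m.-tuple 'I_p => [tuple of q.1 :: q.2])) //=.
exists (fun s : m.+1.-tuple 'I_p => (thead s, [tuple of behead s])) => [[a s] _|s _] /=.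
  by congr (_, _); apply: val_inj.
by rewrite -tuple_eta.
Qed.

(** The outer bound n and the letter y, which carries the exponent n - n_1, are
    generalized so that peeling n_1 leaves a sum of the same form, with bound
    n_1 and letter x_1. *)
Lemma sum_tuples_chain (Q : comPzRingType) (p : nat) (y : Q) k x n :
  units_below Q p -> (n < p)%N -> all (leq 1) k ->
  \sum_(s : (size k).-tuple 'I_p
        | path geq n (map val s) && all (leq 1) (map val s))
    y ^+ (n - nth 0%N (map val s) 0) *
    \prod_(i < size k)
      (nth 0 x i ^+ (nth 0%N (map val s) i - nth 0%N (map val s) i.+1)
       * pz_inv ((nth 0%N (map val s) i)%:R ^+ nth 0%N k i))
  = chain (word y k x) n.
Proof.
move=> up; elim: k y x n => [|k0 k IH] y x n np.
  move=> _; rewrite (big_pred1 [tuple]) => [|s]; last first.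
    by rewrite (tuple0 s) /= eqxx.
  by rewrite big_ord0 mulr1 subn0.
move=> /andP[k0_gt0 k_gt0].
rewrite (@sum_tuple_cons Q p (size k)
  (fun s => path geq n s && all (leq 1) s)
  (fun s => y ^+ (n - nth 0%N s 0) * \prod_(i < (size k).+1)
      (nth 0 x i ^+ (nth 0%N s i - nth 0%N s i.+1)
       * pz_inv ((nth 0%N s i)%:R ^+ nth 0%N (k0 :: k) i)))).
rewrite [word _ _ _]/= chain_cons; last by rewrite size_cat addn_gt0 word_neq0 orbT.
(* G a collects the terms with n_1 = a. *)
pose G a := y ^+ (n - a)
  * (pz_inv a%:R * chain (nseq k0.-1 0 ++ word (head 0 x) k (behead x)) a).
transitivity (\sum_(a < p | (0 < a <= n)%N) G a); last first.
  transitivity (\sum_(1 <= a < n.+1) G a); last by rewrite big_add1 /= big_mkord.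
  rewrite -(big_mkord (fun a => 0 < a <= n)%N G) (big_nat_widenl 1 0) //.
  by rewrite (big_nat_widen _ n.+1 p) //; apply: eq_bigl => a; rewrite /= ltnS andbC.
rewrite [RHS]big_mkcond; apply: eq_bigr => a _ /=.
case: ifP => [/andP[a0 an]|aF]; last first.
  rewrite big_pred0 // => s.
  by apply: contraFF aF => /andP[/andP[an _] /andP[a0 _]]; rewrite a0.
rewrite /G; have ap : (a < p)%N by [].
move: (nat_of_ord a) a0 an ap => {}a a0 an ap.
have -> : pz_inv a%:R * chain (nseq k0.-1 0 ++ word (head 0 x) k (behead x)) a
        = pz_inv (a%:R ^+ k0) * chain (word (head 0 x) k (behead x)) a.
  case: a a0 ap {an} => // a _ ap.
  rewrite chain_zeros ?word_neq0 // mulrA -exprS prednK //; congr (_ * _).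
  apply/esym/pz_invP; rewrite -exprMn (mulr_pz_inv up) ?expr1n //.
rewrite -IH // !mulr_sumr; apply: eq_big => s; first by rewrite an a0.
move=> _; rewrite big_ord_recl /= nth0 !mulrA; congr (_ * _); first ring.
by apply: eq_bigr => i _; rewrite nth_behead.
Qed.

(** The outermost letter is 1 since no power of a variable is attached to the
    difference between p - 1 and n_1. *)
Lemma polylog_sum_chain (Q : comPzRingType) (p : nat) k (x : seq Q) :
  units_below Q p -> (0 < p)%N -> all (leq 1) k ->
  polylog_sum p k x = chain (word 1 k x) p.-1.
Proof.
move=> up p0 k1; rewrite -(sum_tuples_chain 1 x up) //; last by lia.
apply: eq_big => s; last by move=> _; rewrite expr1n mul1r.
case: k {k1} s => [|k0 k] s; first by rewrite (tuple0 s).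
by case/tupleP: s => a s /=; have -> : (a <= p.-1)%N by have := ltn_ord a; lia.
Qed.

(** * The word of the Hoffman dual *)

(** The concatenation over a < i <= a + n of the blocks e, ..., e, s_i of length
    k_i.  Words (e = 0), their images under t |-> 1 - t (e = 1) and the
    membership masks of a set of partial sums of k (e = true) all have this
    shape. *)
Definition spread (A : Type) (e : A) (k : seq nat) (s : nat -> A) (a n : nat) :=
  flatten [seq rcons (nseq (nth 0%N k i).-1 e) (s i.+1) | i <- iota a n].

Lemma spreadS (A : Type) (e : A) k s a n :
  spread e k s a n.+1 = nseq (nth 0%N k a).-1 e ++ s a.+1 :: spread e k s a.+1 n.
Proof. by rewrite /spread /= cat_rcons. Qed.

Lemma spread_rcons (A : Type) (e : A) k s a n :
  spread e k s a n.+1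
  = rcons (spread e k s a n ++ nseq (nth 0%N k (a + n)).-1 e) (s (a + n).+1).
Proof.
by rewrite /spread -addn1 iotaD map_cat flatten_cat /= cats0 rcons_cat.
Qed.

Lemma eq_spread (A : Type) (e : A) k s s' a n :
  (forall i, (a < i <= a + n)%N -> s i = s' i) ->
  spread e k s a n = spread e k s' a n.
Proof.
move=> ss'; congr flatten; apply/eq_in_map => i; rewrite mem_iota => ia.
by rewrite ss' // ltnS; lia.
Qed.

Lemma map_spread (A B : Type) (f : A -> B) e k s a n :
  map f (spread e k s a n) = spread (f e) k (f \o s) a n.
Proof.
rewrite /spread map_flatten -map_comp; congr flatten; apply: eq_map => i /=.
by rewrite map_rcons map_nseq.
Qed.

Lemma word_spread (R : comPzRingType) (y : R) k x :
  word y k x = y :: spread 0 k (fun i => nth 0 x i.-1) 0 (size k).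
Proof.
elim: k y x => [|k0 k IH] y x //=; rewrite spreadS IH nth0; congr (_ :: _ ++ _ :: _).
rewrite /spread (iotaDl 1 0) -map_comp; congr flatten; apply: eq_map => i /=.
by rewrite nth_behead.
Qed.

(** Erasing zero letters while recording the positions of the others is inverse
    to the construction of a word: b marks the positions kept.  The offset
    a - a0 counts the zeros read since the last kept position, and the condition
    on [last] says that no zero is left pending at the end. *)
Lemma word_mask (R : comPzRingType) (y : R) a0 a (b : seq bool) (z : seq R) :
  (a0 <= a)%N -> last (a0 == a) b -> all2 (fun c x => c || (x == 0)) b z ->
  word y (pairmap (fun i j => (j - i)%N) a0 (mask b (iota a.+1 (size b)))) (mask b z)
  = y :: nseq (a - a0) 0 ++ z.
Proof.
elim: b y a0 a z => [|c b IH] y a0 a [|x z] //=.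
  by move=> _ /eqP ->; rewrite subnn.
move=> a0a lb /andP[cx bz]; case: c lb cx => /= lb cx.
  rewrite IH ?leqnn ?eqxx // subnn.
  by congr (_ :: nseq _ _ ++ _); lia.
rewrite IH //; last 2 first.
- exact: leqW.
- by have -> : a0 == a.+1 = false by lia.
by rewrite (eqP cx) subSn // -addn1 nseqD -catA.
Qed.

Lemma mask_spread (A : Type) (e : A) k (P : pred nat) s a n :
  mask (spread true k P a n) (spread e k s a n)
  = flatten [seq nseq (nth 0%N k i).-1 e ++ nseq (P i.+1) (s i.+1) | i <- iota a n].
Proof.
elim: n a => [|n IH] a //=; rewrite !spreadS mask_cat ?size_nseq //.
by rewrite mask_true ?size_nseq // mask_cons IH catA.
Qed.

Lemma all2_spread (A : Type) (B : Type) (r : A -> B -> bool) e e' k s s' a n :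
  r e e' -> (forall i, (a < i <= a + n)%N -> r (s i) (s' i)) ->
  all2 r (spread e k s a n) (spread e' k s' a n).
Proof.
move=> ree; elim: n a => [|n IH] a rs //.
rewrite !spreadS; elim: (_.-1) => [|d IHd] /=; last by rewrite ree.
by rewrite rs ?IH //; [move=> i ia; apply: rs|]; lia.
Qed.

Lemma block_sum_cat k a b c : (a <= b <= c)%N ->
  block_sum k a c = (block_sum k a b + block_sum k b c)%N.
Proof. by move=> /andP[ab bc]; rewrite /block_sum (big_cat_nat ab bc). Qed.

Lemma block_sumxx k a : block_sum k a a = 0%N.
Proof. by rewrite /block_sum big_geq. Qed.

Lemma block_sum1 k a : block_sum k a a.+1 = nth 0%N k a.
Proof. by rewrite /block_sum big_nat1. Qed.

Lemma block_sum_ge k a b : all (leq 1) k -> (a <= b <= size k)%N ->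
  (b - a <= block_sum k a b)%N.
Proof.
move=> k1 /andP[ab bk]; rewrite -[X in (X <= _)%N]muln1 -sum_nat_const_nat.
rewrite /block_sum big_nat_cond [X in (_ <= X)%N]big_nat_cond.
apply: leq_sum => i; rewrite andbT => /andP[_ ib].
by apply: (allP k1); rewrite mem_nth //; apply: leq_trans bk.
Qed.

Lemma block_sumB k a b : block_sum k a b = (block_sum k 0 b - block_sum k 0 a)%N.
Proof.
have [ab|ba] := leqP a b.
  by rewrite (@block_sum_cat k 0 a b) ?ab // addKn.
rewrite {1}/block_sum big_geq ?(ltnW ba) // (@block_sum_cat k 0 b a) ?(ltnW ba) //; lia.
Qed.

Lemma block_sum_lt k a b : all (leq 1) k -> (a < b <= size k)%N ->
  (block_sum k 0 a < block_sum k 0 b)%N.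
Proof.
move=> k1 /andP[ab bk]; rewrite (@block_sum_cat k 0 a b) ?(ltnW ab) //.
by have := @block_sum_ge k a b k1; rewrite (ltnW ab) bk => /(_ isT); lia.
Qed.

Lemma block_sum_inj k : all (leq 1) k ->
  {in [pred i | i <= size k]%N &, injective (block_sum k 0)}.
Proof.
move=> k1 a b; rewrite !inE => ak bk e.
by case: (ltngtP a b) => // ab; have := block_sum_lt k1 (a := _) (b := _);
  [move/(_ a b)|move/(_ b a)]; rewrite ab e ltnn ?ak ?bk => /(_ isT).
Qed.

(** The entries of k_S are differences of partial sums of k, so psi(k_S) consists
    of the partial sums k_1 + ... + k_i for i in S. *)
Lemma merge_indexE k S :
  merge_index k S = index_of (block_sum k 0 (size k)) (map (block_sum k 0) S).
Proof.
suff gen a s : pairmap (block_sum k) a s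
    = pairmap (fun a b => (b - a)%N) (block_sum k 0 a) (map (block_sum k 0) s).
  by rewrite /merge_index gen block_sumxx map_rcons.
by elim: s a => [|b s IH] a //=; rewrite IH block_sumB.
Qed.

(** Inside the block of k_i only the last position can be a partial sum of k, and
    by strict monotonicity it belongs to those of S if and only if i does. *)
Lemma notin_block_sums k (S : seq nat) a n :
  all (leq 1) k -> all (fun i => 0 < i < size k)%N S -> (a + n <= size k)%N ->
  [seq c \notin map (block_sum k 0) S
    | c <- iota (block_sum k 0 a).+1 (block_sum k a (a + n))]
  = spread true k (fun i => i \notin S) a n.
Proof.
move=> k1 Sk; elim: n a => [|n IH] a ank; first by rewrite addn0 block_sumxx.
have ak : (a < size k)%N by lia.
have ka : (0 < nth 0 k a)%N by apply: (allP k1); apply: mem_nth.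
rewrite spreadS -IH ?addSnnS //.
rewrite (@block_sum_cat k a a.+1) ?block_sum1; last by lia.
rewrite iotaD map_cat -cat_rcons.
have -> : ((block_sum k 0 a).+1 + nth 0 k a = (block_sum k 0 a.+1).+1)%N.
  by rewrite (@block_sum_cat k 0 a a.+1) ?block_sum1 // leqnSn.
congr (_ ++ _).
rewrite -[in LHS](prednK ka) -[X in iota _ X]addn1 iotaD map_cat cats1 /=.
have -> : ((block_sum k 0 a).+1 + (nth 0 k a).-1 = block_sum k 0 a.+1)%N.
  by rewrite (@block_sum_cat k 0 a a.+1) ?block_sum1 ?leqnSn //; lia.
congr rcons; last first.
  congr (~~ _); apply/mapP/idP => [[i iS]|aS]; last by exists a.+1.
  have /andP[_ ik] := allP Sk _ iS.
  by move/(block_sum_inj k1) => ->; rewrite ?inE //; lia.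
(* Positions strictly between two consecutive partial sums. *)
apply: (@eq_from_nth _ true); first by rewrite size_map size_iota size_nseq.
move=> d; rewrite size_map size_iota => dk.
rewrite (nth_map 0%N) ?size_iota // nth_iota // nth_nseq dk.
apply/mapP => -[i iS e]; have /andP[_ ik] := allP Sk _ iS.
have [ia|ai] := leqP i a.
  by have := @block_sum_cat k 0 i a; rewrite ia => /(_ isT); lia.
have := @block_sum_cat k 0 a.+1 i; rewrite ai => /(_ isT).
by rewrite (@block_sum_cat k 0 a a.+1) ?block_sum1 ?leqnSn //; lia.
Qed.

Lemma merge_indexP k S :
  is_index k -> sorted ltn S -> all (fun i => 0 < i < size k)%N S ->
  [/\ is_index (merge_index k S),
      sumn (merge_index k S) = block_sum k 0 (size k)
    & psi (merge_index k S) = map (block_sum k 0) S].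
Proof.
case/andP=> k0 k1 Ss Sk; rewrite merge_indexE; apply: index_ofK.
- by rewrite -{1}(block_sumxx k 0) block_sum_lt // k0 leqnn.
- apply: (homo_sorted_in _ _ Ss); last exact: Sk.
  move=> i l /andP[_ ik] /andP[_ lk] il.
  by apply: block_sum_lt => //; rewrite (il : i < l)%N ltnW.
- apply/allP => _ /mapP[i /(allP Sk)/andP[i0 ik] ->].
  rewrite -{1}(block_sumxx k 0).
  by rewrite !block_sum_lt // ?i0 ?ik ?leqnn // ltnW.
Qed.

(** Adjoining the weight w to the complement of psi(k_S) in {1, ..., w - 1} gives
    all positions of {1, ..., w} that are not partial sums indexed by S. *)
Lemma hoffman_dual_merge k S :
  is_index k -> sorted ltn S -> all (fun i => 0 < i < size k)%N S ->
  let b := spread true k (fun i => i \notin S) 0 (size k) in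
  hoffman_dual (merge_index k S)
  = pairmap (fun i j => (j - i)%N) 0 (mask b (iota 1 (size b))).
Proof.
move=> ki Ss Sk b; have [_ sw psw] := merge_indexP ki Ss Sk.
have /andP[k0 k1] := ki.
rewrite /hoffman_dual sw psw /index_of; congr pairmap.
set w := block_sum k 0 (size k); set KS := map _ S.
have w0 : (0 < w)%N by rewrite -{1}(block_sumxx k 0) block_sum_lt // k0 leqnn.
have bE : [seq c \notin KS | c <- iota 1 w] = b.
  by rewrite /b -(notin_block_sums k1 Sk) // block_sumxx.
have -> : size b = w by rewrite -bE size_map size_iota.
rewrite -bE -filter_mask.
rewrite -[in RHS](prednK w0) -[w.-1.+1]addn1 iotaD filter_cat /= add1n prednK //.
have -> : w \notin KS; last by rewrite cats1.
apply/mapP => -[i /(allP Sk)/andP[_ ik] e].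
have := block_sum_lt (k := k) (a := i) (b := size k) k1.
by rewrite ik leqnn -/w e ltnn => /(_ isT).
Qed.

(** This is [dual_args] with an arbitrary starting point a in place of j_0 = 0, as
    induction on j requires. *)
Definition blocks_args (R : comPzRingType) (k : seq nat) (t : nat -> R) a j :=
  flatten [seq rcons (nseq lj.1 1) (1 - t lj.2)
    | lj <- zip (pairmap (fun a b => (block_sum k a b + a - b)%N) a j) j].

Lemma size_blocks_args (R : comPzRingType) k (t : nat -> R) a j :
  all (leq 1) k -> path ltn a j -> (last a j <= size k)%N ->
  size (blocks_args k t a j)
  = (block_sum k a (last a j) + a - last a j + size j)%N.
Proof.
move=> k1; elim: j a => [|b j IH] a /=; first by rewrite block_sumxx; lia.
move=> /andP[ab pj] lk; rewrite /blocks_args /= size_cat size_rcons size_nseq IH //.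
have bl : (b <= last b j)%N.
  by elim: j b {IH lk ab} pj => //= c j IH b /andP[bc /IH]; lia.
rewrite (@block_sum_cat k a b (last b j)); last by lia.
have := @block_sum_ge k a b k1; have := @block_sum_ge k b (last b j) k1.
by rewrite bl lk (ltnW ab) (leq_trans bl lk) => /(_ isT) + /(_ isT); lia.
Qed.

(** Walking through the blocks from a on, a0 is the last element of the complement
    of S already met: a block ending in S adds its k_i - 1 ones to the pending
    run of ones, any other block closes the run with 1 - t_i.  The length c of
    the last run is determined by the sizes, so its formula is left out. *)
Lemma blocks_args_compl (R : comPzRingType) k (S : seq nat) (t : nat -> R) a0 a n :
  all (leq 1) k -> (a0 <= a)%N -> (a + n <= size k)%N ->
  exists c,
    nseq (block_sum k a0 a + a0 - a) 1 ++
    flatten [seq nseq (nth 0%N k i).-1 1 ++ nseq (i.+1 \notin S) (1 - t i.+1)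
              | i <- iota a n]
    = blocks_args k t a0 [seq j <- iota a.+1 n | j \notin S] ++ nseq c 1.
Proof.
move=> k1; elim: n a0 a => [|n IH] a0 a a0a ank.
  by exists (block_sum k a0 a + a0 - a)%N; rewrite /= cats0.
have ak : (a < size k)%N by lia.
have ka : (0 < nth 0 k a)%N by apply: (allP k1); apply: mem_nth.
have bg : (a - a0 <= block_sum k a0 a)%N by apply: block_sum_ge => //; lia.
have bS : block_sum k a0 a.+1 = (block_sum k a0 a + nth 0 k a)%N.
  by rewrite (@block_sum_cat k a0 a a.+1) ?block_sum1 // a0a leqnSn.
have merge : (block_sum k a0 a + a0 - a + (nth 0 k a).-1
            = block_sum k a0 a.+1 + a0 - a.+1)%N by rewrite bS; lia.
rewrite /= !catA -nseqD merge.
case: (a.+1 \in S) => /=.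
  by rewrite cats0; apply: IH; lia.
have [||c cE] := IH a.+1 a.+1; [by []|by lia|].
exists c; rewrite /blocks_args /= -cats1 -!catA; congr (_ ++ _ :: _).
by rewrite -/(blocks_args k t _ _) -cE block_sumxx add0n subnn.
Qed.

(** The last letter z is kept apart from the t_i because the two sums on the
    right-hand side of the functional equation differ in it alone. *)
Lemma mask_dual_args (R : comPzRingType) k S (t : nat -> R) (z : R) :
  is_index k -> sorted ltn S -> all (fun i => 0 < i < size k)%N S ->
  let m := size k in
  let j := compl k S in
  let dual := hoffman_dual (merge_index k S) in
  let letter i := if i == m then z else if i \in S then 0 else 1 - t i in
  (M_last k j < size dual)%N /\
  mask (spread true k (fun i => i \notin S) 0 m) (spread 1 k letter 0 m)
  = dual_args k j t ++ nseq (size dual - M_last k j - 1) 1 ++ [:: z].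
Proof.
move=> ki Ss Sk m j dual s; have /andP[k0 k1] := ki.
have m0 : m = m.-1.+1 by rewrite prednK.
have mS : m \notin S by apply/negP => /(allP Sk); rewrite ltnn andbF.
have [||c cE] := @blocks_args_compl R k S t 0 0 m.-1 k1; [by []|by rewrite /m; lia|].
set b := spread true _ _ _ _.
have mc : mask b (spread 1 k s 0 m)
        = dual_args k j t ++ nseq (c + (nth 0%N k m.-1).-1) 1 ++ [:: z].
  rewrite /b mask_spread [X in iota 0 X]m0 -addn1 iotaD map_cat flatten_cat /=.
  rewrite -m0 mS /s eqxx cats0 nseqD !catA; congr ((_ ++ _) ++ _).
  rewrite block_sumxx /= in cE; rewrite /dual_args -[RHS]cE.
  congr flatten; apply/eq_in_map => i; rewrite mem_iota add0n => /= im.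
  have -> : (i.+1 == m) = false by lia.
  by case: (_ \in S).
have jM : size (dual_args k j t) = M_last k j.
  rewrite [LHS](@size_blocks_args _ k t 0 j) ?addn0 //.
    exact: (subseq_path ltn_trans (filter_subseq _ _) (iota_ltn_sorted 0 m.-1.+1)).
  have := mem_last 0%N j; rewrite inE => /predU1P[->//|].
  rewrite mem_filter mem_iota add1n prednK // => /and3P[_ _].
  exact: ltnW.
have : size dual = size (mask b (spread 1 k s 0 m)).
  rewrite /dual hoffman_dual_merge // size_pairmap !size_mask ?size_iota //.
  have : all2 (fun _ (_ : R) => true) b (spread 1 k s 0 m) by apply: all2_spread.
  by rewrite all2E => /andP[/eqP].
rewrite mc !size_cat size_nseq /= jM => ->; split; first lia.
by congr (_ ++ nseq _ _ ++ _); lia.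
Qed.

(** The right-hand side is the word of k with every letter replaced by 1 minus it:
    a zero becomes 1, and t_i = 1 becomes 0 when i is in S. *)
Lemma word_dual_args (R : comPzRingType) k S (t : nat -> R) (z : R) :
  is_index k -> sorted ltn S -> all (fun i => 0 < i < size k)%N S ->
  let m := size k in
  let j := compl k S in
  let dual := hoffman_dual (merge_index k S) in
  word 1 dual
    (dual_args k j t ++ nseq (size dual - M_last k j - 1) 1 ++ [:: z])
  = 1 :: rcons (spread 1 k (fun i => if i \in S then 0 else 1 - t i) 0 m.-1
                ++ nseq (nth 0%N k m.-1).-1 1) z.
Proof.
move=> ki Ss Sk m j dual; have /andP[k0 _] := ki.
have m0 : m = m.-1.+1 by rewrite prednK.
have mS : m \notin S by apply/negP => /(allP Sk); rewrite ltnn andbF.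
have [_ <-] := mask_dual_args t z ki Ss Sk; rewrite /dual hoffman_dual_merge //.
rewrite -/m word_mask //.
- rewrite subn0 /= [X in spread _ _ _ _ X]m0 spread_rcons add0n -m0 eqxx.
  congr (_ :: rcons (_ ++ _) _); apply: eq_spread => i im.
  by have -> : (i == m) = false by lia.
- by rewrite [X in spread _ _ _ _ X]m0 spread_rcons last_rcons add0n -m0.
- apply: all2_spread => // i _; case: (eqVneq i m) => [->|_]; first by rewrite mS.
  by case: (i \in S); rewrite ?eqxx.
Qed.

(** * The functional equation *)

Lemma mod_p2_units (R : comPzRingType) (p : nat) :
  prime p -> units_below (mod_p2 R p) p.
Proof. by move=> pp n; apply: natr_mod_p2_unit. Qed.

Lemma mod_p2_sqr (R : comPzRingType) (p : nat) :
  p%:R * p%:R = 0 :> mod_p2 R p.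
Proof.
rewrite -natrM mulnn -(rmorph_nat (quot_proj (p2_ideal R p))).
rewrite -(rmorph0 (quot_proj (p2_ideal R p))).
by apply/quot_proj_eq; rewrite subr0; apply/asboolP; exists 1; rewrite mulr1.
Qed.

(** The words of the three sums end in the same list b and begin with 1, with
    1, 1 and with 1, 0, so all three are double sums at most over the sequence
    of b, where the harmonic sums of [signed_bin_mod_sqr] can be recognized. *)
Lemma polylog_sum_correction (Q : comPzRingType) (p : nat) k (x : seq Q) :
  units_below Q p -> p%:R * p%:R = 0 :> Q -> odd p -> is_index k ->
  polylog_sum p k x
  + (polylog_sum p (1%N :: k) (1 :: x)
     - polylog_sum p ((nth 0%N k 0).+1 :: behead k) x) * p%:R
  = binomial_transform (chain (word 0 k x)) p.-1.
Proof.
move=> up pp odp /andP[k0 k1]; have p0 : (0 < p)%N by case: (p) odp.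
case: k k0 k1 => // k0 k _ k1; have /andP[k0_gt0 k_gt0] := k1.
rewrite !(polylog_sum_chain _ up) //.
set b := nseq k0.-1 0 ++ word (head 0 x) k (behead x).
have b0 : (0 < size b)%N by rewrite size_cat addn_gt0 word_neq0 orbT.
have -> y : word y (k0 :: k) x = y :: b by [].
have -> : word 1 (1%N :: k0 :: k) (1 :: x) = [:: 1, 1 & b] by [].
have -> : word 1 ((nth 0%N (k0 :: k) 0).+1 :: behead (k0 :: k)) x = [:: 1, 0 & b].
  by rewrite /= -{1}(prednK k0_gt0).
rewrite !chain_cons //.
exact: binomial_transform_mod_sqr.
Qed.

(** At a single odd prime the variables may be arbitrary ring elements: all that
    matters is that those with index in S equal 1, so that 1 - t vanishes there. *)
Lemma polylog_sum_duality (R : comPzRingType) (p : nat) k S (t : nat -> R) x :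
  prime p -> odd p ->
  is_index k -> sorted ltn S -> all (fun i => 0 < i < size k)%N S ->
  size x = size k ->
  (forall i, (i < size k)%N -> nth 0 x i = if i.+1 \in S then 1 else t i.+1) ->
  let m := size k in
  let j := compl k S in
  let dual := hoffman_dual (merge_index k S) in
  let args z := dual_args k j t ++ nseq (size dual - M_last k j - 1) 1 ++ [:: z] in
  let reduce := map (quot_proj (p2_ideal R p)) in
  polylog_sum p k (reduce x)
  + (polylog_sum p (1%N :: k) (1 :: reduce x)
     - polylog_sum p ((nth 0%N k 0).+1 :: behead k) (reduce x)) * p%:R
  = polylog_sum p dual (reduce (args (1 - t m))) - polylog_sum p dual (reduce (args 1)).
Proof.
move=> pp odp ki Ss Sk sx xE m j dual args reduce.
have up := mod_p2_units R pp; have p0 := prime_gt0 pp.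
have [mi _ _] := merge_indexP ki Ss Sk.
have [/andP[_ dual1] _ _] := hoffman_dualP mi.
have /andP[k0 k1] := ki; have m0 : m = m.-1.+1 by rewrite prednK.
rewrite (polylog_sum_correction _ up (mod_p2_sqr R p) odp ki).
rewrite !(polylog_sum_chain _ up) //.
have argsE z : word 1 dual (reduce (args z)) = reduce (word 1 dual (args z)).
  by rewrite /reduce map_word rmorph1.
rewrite !argsE !word_dual_args //.
rewrite word_spread -/m [X in spread _ _ _ _ X]m0 spread_rcons add0n -m0.
set prefix := spread 0 _ _ _ _ ++ _; set z := nth 0 _ _.
(* The subtracted initial value is that of a nonempty sum, hence 0. *)
rewrite -[LHS]subr0 -[X in _ - X = _](star_step0 0 (chain (rcons prefix z))).
rewrite -chain_cons ?size_rcons // -[0 :: rcons prefix z]rcons_cons.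
rewrite (binomial_transform_chain _ _ up) ?prednK //.
rewrite /prefix /z /reduce !map_cons !map_rcons /= !map_cat !map_spread !map_nseq.
rewrite !rmorph1 !subr0.
have tm : nth 0 (map (quot_proj (p2_ideal R p)) x) m.-1 = quot_proj (p2_ideal R p) (t m).
  rewrite (nth_map 0) ?sx -?/m; last by rewrite [X in (_ < X)%N]m0.
  rewrite xE -/m; last by rewrite [X in (_ < X)%N]m0.
  by rewrite -m0; case: ifP => // /(allP Sk); rewrite -/m ltnn andbF.
rewrite tm rmorphB rmorph1.
have -> // : spread 1 k
    ((fun y => 1 - y) \o (fun i => nth 0 (map (quot_proj (p2_ideal R p)) x) i.-1)) 0 m.-1
  = spread 1 k (quot_proj (p2_ideal R p) \o (fun i => if i \in S then 0 else 1 - t i)) 0 m.-1.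
apply: eq_spread => i /andP[i0 im] /=.
have ik : (i.-1 < size k)%N by rewrite -/m; lia.
rewrite (nth_map 0) ?sx // xE // prednK //.
by case: (i \in S); rewrite ?rmorphB ?rmorph1 ?subrr ?rmorph0.
Qed.

Theorem corollary3p13 (k S : seq nat)
    (k_index : is_index k)
    (S_sorted : sorted ltn S)
    (S_sub : all (fun i => (0 < i < size k)%N) S) :
  let m := size k in
  let j := compl k S in
  let t := tvar j in
  let dual := hoffman_dual (merge_index k S) in
  let m' := size dual in
  let M := M_last k j in
  A2_map (comp_mpoly (subst1 k S))
    (polylog k (vars m)
     + (polylog (1%N :: k) (1 :: vars m)
        - polylog ((nth 0%N k 0).+1 :: behead k) (vars m)) * A2_p _)
  = polylog dual (dual_args k j t ++ nseq (m' - M - 1) 1 ++ [:: 1 - t m])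
    - polylog dual (dual_args k j t ++ nseq (m' - M) 1).
Proof.
move=> m j t dual m' M.
rewrite rmorphD rmorphM rmorphB /= !A2_map_polylog A2_map_p map_cons rmorph1.
have -> : map (comp_mpoly (subst1 k S)) (vars m) = subst1 k S.
  rewrite -map_comp -[RHS](map_tnth_enum).
  by apply: eq_map => i /=; rewrite comp_mpolyXU -tnth_nth.
(* So the run of m' - M ones is nonempty, and its last 1 takes the place of
   1 - t_m in the first sum. *)
have [Mm _] := mask_dual_args t 0 k_index S_sorted S_sub.
rewrite -/j -/dual -/m' -/M in Mm.
have -> : nseq (m' - M) (1 : {mpoly int[(size j).+1]}) = nseq (m' - M - 1) 1 ++ [:: 1].
  have {1}-> : (m' - M = (m' - M - 1) + 1)%N by lia.
  by rewrite nseqD.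
rewrite /polylog /A2_p /A2_class -!rmorphB -rmorphM -rmorphD.
pose two : prime_nat := exist _ 2%N isT.
apply/A2_class_eq; exists [:: two] => -[p pp]; rewrite inE => p2.
have odp : odd p.
  have [p2E|//] := even_prime pp; case/eqP: p2.
  exact: (val_inj : injective (val : {q | prime q} -> nat)).
apply: (polylog_sum_duality pp odp k_index S_sorted S_sub).
  exact: size_tuple.
by move=> i ik; rewrite -[i]/(nat_of_ord (Ordinal ik)) -tnth_nth tnth_mktuple.
Qed.
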